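(* For every $\varepsilon\in(0,1/2)$ there exists $r_\varepsilon$ such that for every finite group $R$ of order $r\ge r_\varepsilon$, the number of subsets $S\subseteq R$ such that $\mathrm{Aut}(\Gamma(R,S))$ contains a subgroup $G$ with $R<G$, $R$ maximal in $G$, $|G_1|>2^{r^{1/2-\varepsilon}}$, and $|G_R|>4\log_2 r$ where $G_R:=\bigcap_{g\in G}R^g$, is at most $2^{\,r-\frac{r}{4\log_2 r}\log_2(e)-\log_2(4\log_2 r)+(\log_2 r)^2+\log_2 r}$.
   Context: For a finite group $R$ and $S\subseteq R$, the Cayley digraph $\Gamma(R,S)$ has vertex set $R$ and $(g,h)$ is an arc iff $hg^{-1}\in S$. $R$ is identified with its right regular representation, a subgroup of $\mathrm{Aut}(\Gamma(R,S))$. $G_1$ denotes the stabiliser in $G$ of the vertex $1$ (the identity of $R$); $G_R$ is the core of $R$ in $G$. *)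

(* Defs.v *)
From mathcomp Require Import all_boot all_order all_fingroup all_solvable all_algebra.
From mathcomp Require Import reals sequences exp.
Set Implicit Arguments.
Unset Strict Implicit.
Unset Printing Implicit Defensive.
Import Order.TTheory GRing.Theory Num.Theory.

Local Open Scope group_scope.

Section Digraph.
Variables (T : finType) (e : rel T).

Definition dgAut : {set {perm T}} :=
  [set f : {perm T} | [forall x, forall y, e (f x) (f y) == e x y]].

Lemma dgAutP (f : {perm T}) :
  reflect (forall x y, e (f x) (f y) = e x y) (f \in dgAut).
Proof.
rewrite inE; apply: (iffP forallP) => H x; last by apply/forallP => y; apply/eqP.
by move=> y; move/forallP: (H x) => /(_ y) /eqP.
Qed.

Lemma dgAut_group_set : group_set dgAut.
Proof.
apply/group_setP; split; first by apply/dgAutP => x y; rewrite !perm1.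
move=> f g /dgAutP Hf /dgAutP Hg; apply/dgAutP => x y.
by rewrite !permM Hg Hf.
Qed.

Canonical dgAut_group := Group dgAut_group_set.
End Digraph.

Section Cayley.
Variable gT : finGroupType.

Definition cayley_arc (S : {set gT}) : rel gT := fun g h => h * g^-1 \in S.

(* The permutations x |-> x * g: mathcomp composes permutations from left to
   right, so this is the image of a homomorphism defined on the whole of gT. *)
Definition right_regular : {group {perm gT}} :=
  (actperm ('R)%act @* [set: gT])%G.

Lemma right_regular_sub (S : {set gT}) :
  right_regular \subset dgAut (cayley_arc S).
Proof.
apply/subsetP => _ /morphimP [a _ _ ->]; apply/dgAutP => x y.
by rewrite !actpermE /= /cayley_arc invMg mulgA mulgK.
Qed.

Lemma card_right_regular : #|right_regular| = #|gT|.
Proof.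
rewrite /right_regular /= card_injm ?cardsT //.
apply/injmP => a b _ _ E; have := congr1 (fun f : {perm gT} => f 1) E.
by rewrite !actpermE /= !mul1g.
Qed.
End Cayley.

Definition log2 {K : realType} (x : K) : K := (ln x / ln 2)%R.

(* Main.v *)
Require Import Defs.
From mathcomp Require Import all_boot all_order all_fingroup all_solvable all_algebra.
From mathcomp Require Import reals sequences exp.
From mathcomp Require Import zify ring lra.
Set Implicit Arguments.
Unset Strict Implicit.
Unset Printing Implicit Defensive.
Import Order.TTheory GRing.Theory Num.Theory.

(* Let N be the core of R in G, so |N| > 4 log2 r.  Since N is generated by at
   most log2 r elements and |G_1| > r ^ (log2 r), two elements of G_1 induce the
   same conjugation on N; so some c <> 1 in G_1 centralises N, and c is determined
   by its values at one point of each N-orbit.  Let F be the set of fixed points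
   of c, a union of N-orbits.
   If |F| < r / 4, then S is c-invariant: there are at most
   r ^ (r / |N|) <= 2 ^ (r / 4) such c, and each fixes at most 2 ^ (r - 3 r / 8)
   sets S.
   If |F| >= r / 4, take y moved by c and put z = c y: for x in F,
   x y^-1 \in S iff x z^-1 \in S, which leaves at most 2 ^ (r - r / 8) sets S for
   each of the r ^ 2 * 2 ^ (r / |N|) triples (y, z, F).
   Finally there are at most r ^ (log2 r) choices of N. *)

(** * The union bound *)

Section UnionBound.
Local Open Scope nat_scope.

Lemma card_covered_le (I T : finType) (A : {set I}) (F : I -> {set T})
    (B : {set T}) (k : nat) :
    (forall x, x \in B -> exists2 i, i \in A & x \in F i) ->
    (forall i, i \in A -> #|F i| <= k) ->
  #|B| <= #|A| * k.
Proof.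
move=> covB leFk; apply: (@leq_trans #|\bigcup_(i in A) F i|).
  by apply/subset_leq_card/subsetP => x /covB[i Ai Fix]; apply/bigcupP; exists i.
apply: (@leq_trans (\sum_(i in A) #|F i|)).
  elim/big_ind2: _ => [|m U n V leU leV|//]; first by rewrite cards0.
  by rewrite (leq_trans (leq_card_setU U V)) // leq_add.
by rewrite -sum_nat_const; apply: leq_sum.
Qed.

End UnionBound.

(** * Sets in which membership is preserved along a map *)

Section MatchingSets.
Local Open Scope nat_scope.
Variables (T : finType) (f : T -> T).

Definition matching_sets (X : {set T}) : {set {set T}} :=
  [set S : {set T} | [forall x in X, (x \in S) == (f x \in S)]].

Lemma matching_setsP (X S : {set T}) :
  reflect {in X, forall x, (x \in S) = (f x \in S)} (S \in matching_sets X).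
Proof.
by rewrite inE; apply: (iffP forall_inP) => H x Xx; apply/eqP/H.
Qed.

(** As [h] drops at each step of [f] inside [X], iterating [f] from any point leaves [X]; hence [S]
    is determined by [S :\: X]. *)
Lemma card_matching_descent (X : {set T}) (h : T -> nat) :
    {in X, forall x, h (f x) < h x} ->
  #|matching_sets X| <= 2 ^ (#|T| - #|X|).
Proof.
move=> desc; rewrite -(setCK X) -cardsCs -card_powerset setCK.
suff inj: {in matching_sets X &, injective (fun S => S :\: X)}.
  rewrite -(card_in_imset inj) subset_leq_card //.
  apply/subsetP => _ /imsetP[S _ ->]; rewrite inE setDE; exact: subsetIr.
move=> S1 S2 /matching_setsP m1 /matching_setsP m2 eqD.
suff eqS n x : h x < n -> (x \in S1) = (x \in S2).
  by apply/setP => x; exact: eqS (ltnSn _).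
elim: n x => // n IHn x lt_x_n; have [Xx | nXx] := boolP (x \in X).
  by rewrite (m1 x) // (m2 x) //; apply: IHn; apply: leq_trans (desc x Xx) _.
by move/setP/(_ x): eqD; rewrite !inE nXx.
Qed.

(* Fix a linear order on T.  Half of the points of X are mapped by f in the same
   direction, and along a monotone f membership is determined off those points. *)
Lemma card_matching_sets (X : {set T}) (k : nat) :
    {in X, forall x, f x != x} -> 2 * k <= #|X|.+1 ->
  #|matching_sets X| <= 2 ^ (#|T| - k).
Proof.
move=> nfix leXk; pose pos x := index x (enum T).
pose D := [set x | pos (f x) < pos x].
have mono (Y : {set T}) : Y \subset X -> matching_sets X \subset matching_sets Y.
  move/subsetP=> sYX; apply/subsetP => S /matching_setsP mS.
  by apply/matching_setsP => x /sYX; exact: mS.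
have cardX := cardsID D X.
(* One of [X :&: D] and [X :\: D] has at least [k] points: otherwise [#|X| + 2 <= 2 * k]. *)
have [leD | ltD] := leqP k #|X :&: D|.
  apply: leq_trans (subset_leq_card (mono _ (subsetIl X D))) _.
  apply: leq_trans (@card_matching_descent _ pos _) _.
    by move=> x; rewrite !inE => /andP[].
  by rewrite leq_exp2l // leq_sub2l.
apply: leq_trans (subset_leq_card (mono _ (subsetDl X D))) _.
(* Off [D] the position strictly increases along [f], which fixes no point of [X], so the distance
   to the end of the enumeration is the decreasing measure. *)
apply: leq_trans (@card_matching_descent _ (fun x => #|T| - pos x) _) _.
  move=> x; rewrite !inE -leqNgt => /andP[le_f /nfix nf].
  apply: ltn_sub2l; first by rewrite cardT index_mem mem_enum.
  rewrite ltn_neqAle le_f andbT; apply: contra nf => /eqP eq_pos.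
  by rewrite -[f x](nth_index x (mem_enum T _)) -[index _ _]eq_pos nth_index ?mem_enum.
by rewrite leq_exp2l //; lia.
Qed.

End MatchingSets.

(** * Small generating families *)

Section Generators.
Local Open Scope group_scope.

(** An element of [H] outside the subgroup generated so far at least doubles its order, by Lagrange,
    so greedy extension stops in time. In [extend], [n] bounds the order still missing. *)
Lemma generating_seq (gT : finGroupType) (H : {group gT}) :
  exists s : seq gT, <<[set x in s]>> = H /\ (2 ^ size s <= #|H|)%N.
Proof.
pose good (s : seq gT) :=
  <<[set x in s]>> \subset H /\ (2 ^ size s <= #|<<[set x in s]>>|)%N.
suff extend n s : good s -> (#|H| - #|<<[set x in s]>>| <= n)%N ->
    exists2 t, good t & H \subset <<[set x in t]>>.
  have [||t [tH let_] Ht] := extend #|H| [::]; rewrite ?leq_subr //.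
    by rewrite /good set_nil gen0 sub1G cards1.
  have gen_t : <<[set x in t]>> = H by apply/eqP; rewrite eqEsubset tH.
  by exists t; rewrite gen_t in let_ *.
elim: n s => [|n IHn] s [sH les] leHn.
  exists s => //; have /eqP-> : <<[set x in s]>> == H; last by [].
  by rewrite eqEcard sH -subn_eq0 -leqn0.
have [Hs | /subsetPn[x Hx nsx]] := boolP (H \subset <<[set x in s]>>).
  by exists s.
have lt_card : <<[set y in s]>> \proper <<[set y in x :: s]>>.
  rewrite set_cons properE genS ?subsetUr //=; apply/subsetPn; exists x => //.
  by rewrite mem_gen // !inE eqxx.
have sxH : <<[set y in x :: s]>> \subset H.
  by rewrite set_cons gen_subG subUset sub1set Hx -gen_subG.
apply: (IHn (x :: s)).
  split=> //=; rewrite expnS -(Lagrange (proper_sub lt_card)) mulnC leq_mul //.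
  by rewrite indexg_gt1 proper_subn.
rewrite -ltnS (leq_trans _ leHn) // ltn_sub2l ?proper_card //.
exact: proper_sub_trans lt_card sxH.
Qed.

(** Padding with [1] fixes the length, so that one power of [#|gT|] bounds both the number of
    subgroups and the number of images of a generating tuple. *)
Lemma generating_tuple (gT : finGroupType) (H : {group gT}) :
  exists t : (trunc_log 2 #|gT|).-tuple gT, <<[set x in t]>> = H.
Proof.
have [s [gens les]] := generating_seq H.
have le_s : (size s <= trunc_log 2 #|gT|)%N.
  by apply: trunc_log_max => //; rewrite (leq_trans les) // max_card.
have size_pad : size (s ++ nseq (trunc_log 2 #|gT| - size s) 1) == trunc_log 2 #|gT|.
  by rewrite size_cat size_nseq subnKC.
exists (Tuple size_pad); rewrite -gens; apply/eqP.
rewrite eqEsubset !gen_subG; apply/andP; split; apply/subsetP => x.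
  by rewrite !inE memtE mem_cat => /orP[sx | /nseqP[-> _]]; rewrite ?group1 ?mem_gen ?inE.
by rewrite inE => sx; rewrite mem_gen // inE memtE mem_cat sx.
Qed.

End Generators.

(** * Permutations commuting with right translations by a subgroup *)

Section Equivariant.
Local Open Scope group_scope.
Variables (gT : finGroupType) (H : {group gT}).

(** The centraliser, in the symmetric group, of the right translations by [H]; the orbits of these
    are the left cosets [x *: H]. *)
Definition equivariant : {set {perm gT}} :=
  [set c : {perm gT} | [forall x, forall h in H, c (x * h) == c x * h]].

Lemma equivariantP (c : {perm gT}) :
  reflect (forall x h, h \in H -> c (x * h) = c x * h) (c \in equivariant).
Proof.
rewrite inE; apply: (iffP forallP) => Hc x.
  by move=> h Hh; move/forall_inP: (Hc x) => /(_ h Hh)/eqP.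
by apply/forall_inP => h Hh; apply/eqP/Hc.
Qed.

Lemma mem_repr_lcoset (x : gT) : (repr (x *: H))^-1 * x \in H.
Proof. by rewrite -groupV invMg invgK -mem_lcoset (mem_repr x) ?lcoset_refl. Qed.

Lemma mem_lcosetsT (x : gT) : x *: H \in lcosets H [set: gT].
Proof. by apply/lcosetsP; exists x; rewrite ?inE. Qed.

Lemma card_equivariant : (#|equivariant| <= #|gT| ^ #|[set: gT] : H|)%N.
Proof.
pose D := lcosets H [set: gT].
(* [c] is encoded by its values at coset representatives; the default [1] off [D] places the code
   among the functions supported on [D]. *)
pose v (c : {perm gT}) :=
  [ffun A : {set gT} => if A \in D then c (repr A) else 1].
have inj_v : {in equivariant &, injective v}.
  move=> c d /equivariantP ec /equivariantP ed /ffunP eq_v; apply/permP => x.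
  rewrite -(mulKVg (repr (x *: H)) x) ec ?ed ?mem_repr_lcoset //; congr (_ * _).
  by have:= eq_v (x *: H); rewrite !ffunE mem_lcosetsT.
rewrite -(card_in_imset inj_v) -card_lcosets -cardsT.
rewrite -(card_pffun_on 1 (mem D) (mem [set: gT])).
apply/subset_leq_card/subsetP => _ /imsetP[c _ ->]; apply/pffun_onP; split.
  by apply/supportP => A nDA; rewrite ffunE (negPf nDA).
by move=> A _; rewrite inE.
Qed.

Definition coset_unions : {set {set gT}} :=
  [set F : {set gT} | [forall x in F, x *: H \subset F]].

(** A union of cosets is recovered from the set of cosets of its points. *)
Lemma card_coset_unions : (#|coset_unions| <= 2 ^ #|[set: gT] : H|)%N.
Proof.
have inj : {in coset_unions &, injective (fun F : {set gT} => [set x *: H | x in F])}.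
  have sub (F E : {set gT}) : E \in coset_unions ->
      [set x *: H | x in F] = [set x *: H | x in E] -> F \subset E.
    rewrite inE => /forall_inP cE eqFE; apply/subsetP => x Fx.
    have /imsetP[y Ey eq_xy] : x *: H \in [set x *: H | x in E].
      by rewrite -eqFE; apply/imsetP; exists x.
    by apply: (subsetP (cE y Ey)); rewrite -eq_xy lcoset_refl.
  by move=> F E cF cE eqFE; apply/eqP; rewrite eqEsubset !sub.
rewrite -(card_in_imset inj) -card_lcosets -card_powerset subset_leq_card //.
apply/subsetP => _ /imsetP[F _ ->]; rewrite inE.
by apply/subsetP => _ /imsetP[x _ ->]; rewrite mem_lcosetsT.
Qed.

Lemma fixed_coset_union (c : {perm gT}) :
  c \in equivariant -> [set x | c x == x] \in coset_unions.
Proof.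
move/equivariantP=> ec; rewrite inE; apply/forall_inP => x; rewrite inE => /eqP cx.
by apply/subsetP => _ /lcosetP[h Hh ->]; rewrite inE ec // cx.
Qed.

End Equivariant.

(** * Connection sets admitting an equivariant automorphism that fixes 1 *)

Section SymmetricConnectionSets.
Local Open Scope group_scope.
Variables (gT : finGroupType) (H : {group gT}).
Let r := #|gT|.
Let m := #|[set: gT] : H|.

Definition moving_automorphism_sets : {set {set gT}} :=
  [set S : {set gT} | [exists c in equivariant H,
     [&& c != 1, c 1 == 1 & c \in dgAut (cayley_arc S)]]].

(** With [s = x * y^-1] the shifted point is [x * z^-1], so this says that [x * y^-1] and [x * z^-1]
    are both in [S] or both outside, for each [x] in [F]. *)
Definition shifted_sets (p : gT * gT * {set gT}) : {set {set gT}} :=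
  let: (y, z, F) := p in
  matching_sets (fun s => s * (y * z^-1)) [set x * y^-1 | x in F].

Lemma card_shifted_sets (p : gT * gT * {set gT}) :
    p.1.1 != p.1.2 -> (r <= 4 * #|p.2|)%N ->
  (#|shifted_sets p| <= 2 ^ (r - r %/ 8))%N.
Proof.
case: p => [[y z] F] /= yz leF; apply: card_matching_sets.
  by move=> s _; rewrite -[X in _ != X]mulg1 (inj_eq (mulgI s)) -eq_mulgV1.
have le_k f : (r <= 4 * f -> 2 * (r %/ 8) <= f.+1)%N by lia.
by rewrite card_imset; [exact: le_k | exact: mulIg].
Qed.

Lemma moving_automorphism_setsP (S : {set gT}) :
    S \in moving_automorphism_sets ->
  S \in \bigcup_(c in equivariant H | (3 * r <= 4 * #|[set x | c x != x]|)%N)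
          matching_sets c [set x | c x != x]
   \/ exists2 p : gT * gT * {set gT},
       [&& p.1.1 != p.1.2, (r <= 4 * #|p.2|)%N & p.2 \in coset_unions H] &
       S \in shifted_sets p.
Proof.
rewrite inE => /existsP[c /and4P[ec nc /eqP c1 /dgAutP cS]].
pose F := [set x | c x == x]; have cFM : (#|F| + #|[set x | c x != x]| = r)%N.
  suff <- : ~: F = [set x | c x != x] by exact: cardsC.
  by apply/setP => x; rewrite !inE.
have [leM | ltM] := leqP (3 * r) (4 * #|[set x | c x != x]|).
  left; apply/bigcupP; exists c; rewrite ?ec //.
  (* As [c] fixes [1], it sends the pair [(1, x)] to [(1, c x)]. *)
  apply/matching_setsP => x _; have := cS 1 x.
  by rewrite c1 /cayley_arc invg1 !mulg1.
have [y cy] : exists y, c y != y.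
  apply/existsP; apply: contraR nc; rewrite negb_exists => /forallP fixc.
  by apply/eqP/permP => x; rewrite perm1; have /negbNE/eqP := fixc x.
right; exists (y, c y, F).
  rewrite /= eq_sym cy fixed_coset_union // andbT /=.
  have leF f k : (f + k = r -> 4 * k < 3 * r -> r <= 4 * f)%N by lia.
  exact: leF cFM ltM.
apply/matching_setsP => _ /imsetP[x Fx ->].
(* As [c] fixes [x], it sends the pair [(y, x)] to [(c y, x)]. *)
rewrite mulgA mulgKV; have := cS y x; rewrite /cayley_arc.
by move: Fx; rewrite inE => /eqP ->.
Qed.

(** The hypothesis [r ^ 4 < 2 ^ #|H|] is the integer form of [#|H| > 4 log2 r]. Each of the two
    cases contributes at most [r ^ 2 * 2 ^ (r - r %/ 16)]. *)
Lemma card_moving_automorphism_sets :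
    (1024 <= r)%N -> (r ^ 4 < 2 ^ #|H|)%N ->
  (#|moving_automorphism_sets| <= 2 * r ^ 2 * 2 ^ (r - r %/ 16))%N.
Proof.
move=> r_ge ltH; have rE : (#|H| * m = r)%N by rewrite /m Lagrange ?subsetT ?cardsT.
pose A := \bigcup_(c in equivariant H | (3 * r <= 4 * #|[set x | c x != x]|)%N)
  matching_sets c [set x | c x != x].
have H_gt40 : (40 < #|H|)%N.
  (* From [r >= 2 ^ 10] follows [2 ^ 40 <= r ^ 4]. *)
  rewrite -(ltn_exp2l _ _ (_ : 1 < 2)%N) //; apply: leq_ltn_trans ltH.
  by rewrite (expnM 2 10 4) leq_exp2r.
have le_m : (40 * m <= r)%N by rewrite -rE leq_mul2r (ltnW H_gt40) orbT.
have le_rm : (r ^ m <= 2 ^ (2 * (r %/ 8) + 2))%N.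
  (* Fourth powers are compared: [r ^ (4 * m) <= 2 ^ (#|H| * m) = 2 ^ r], and
     [r < 8 * (r %/ 8) + 8]. *)
  rewrite -(@leq_exp2r _ _ 4) // -!expnM [(m * 4)%N]mulnC expnM.
  apply: (@leq_trans ((2 ^ #|H|) ^ m)); last first.
    by rewrite -expnM rE leq_exp2l //; have := ltn_ceil r (isT : 0 < 8)%N; lia.
  case: (posnP m) => [->|m_gt0]; first by rewrite !expn0.
  by rewrite leq_exp2r // ltnW.
have cardA : (#|A| <= r ^ m * 2 ^ (r - 3 * (r %/ 8)))%N.
  pose E := [set c in equivariant H | (3 * r <= 4 * #|[set x | c x != x]|)%N].
  apply: (@leq_trans (#|E| * 2 ^ (r - 3 * (r %/ 8)))%N).
    apply: (@card_covered_le _ _ _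
      (fun c : {perm gT} => matching_sets c [set x | c x != x])).
  - by move=> S /bigcupP[c cc Sc]; exists c => //; rewrite inE.
  - move=> c; rewrite inE => /andP[_ le_c]; apply: card_matching_sets.
      by move=> x; rewrite inE.
    have le_k k : (3 * r <= 4 * k -> 2 * (3 * (r %/ 8)) <= k.+1)%N by lia.
    exact: le_k.
  rewrite leq_mul2r; apply/orP; right; apply: leq_trans (card_equivariant H).
  by apply/subset_leq_card/subsetP => c; rewrite inE => /andP[].
pose P := [set p : gT * gT * {set gT} |
   [&& p.1.1 != p.1.2, (r <= 4 * #|p.2|)%N & p.2 \in coset_unions H]].
have cardP : (#|P| <= r * r * 2 ^ m)%N.
  apply: leq_trans (subset_leq_card (_ : P \subset setX setT (coset_unions H))) _.
    by apply/subsetP => [[q F]]; rewrite !inE => /and3P[].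
  by rewrite cardsX cardsT card_prod leq_mul // card_coset_unions.
have le_union : (#|moving_automorphism_sets| <= #|A| + #|P| * 2 ^ (r - r %/ 8))%N.
  pose B := moving_automorphism_sets :\: A.
  apply: (@leq_trans (#|A| + #|B|)).
    by rewrite -(cardsID A moving_automorphism_sets) leq_add2r subset_leq_card ?subsetIr.
  rewrite leq_add2l; apply: (@card_covered_le _ _ _ shifted_sets).
    move=> S /setDP[/moving_automorphism_setsP[-> // | [p Pp Sp]] _].
    by exists p; rewrite // inE.
  by move=> p; rewrite inE => /and3P[? ? _]; exact: card_shifted_sets.
apply: leq_trans le_union _; rewrite mul2n -addnn mulnDl.
have r2_gt0 : (0 < r ^ 2)%N by rewrite expn_gt0; lia.
have := ltn_ceil r (isT : 0 < 16)%N; have := leq_divM r 16.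
have := ltn_ceil r (isT : 0 < 8)%N; have := leq_divM r 8.
set q8 := (r %/ 8)%N in le_rm cardA *; set q16 := (r %/ 16)%N => le8 lt8 le16 lt16.
apply: leq_add.
  (* The saving [3 * q8] exceeds the cost [2 * q8 + 2] of choosing [c] by [q8 - 2 >= q16]. *)
  apply: leq_trans cardA _; apply: leq_trans (leq_mul le_rm (leqnn _)) _.
  by rewrite -expnD; apply: leq_trans (leq_pmull _ r2_gt0); rewrite leq_exp2l //; lia.
(* Here [40 * m <= r] gives [q8 - m >= q16]. *)
apply: leq_trans (leq_mul cardP (leqnn _)) _.
rewrite -mulnA -expnD mulnn leq_mul2l; apply/orP; right.
by rewrite leq_exp2l //; lia.
Qed.

End SymmetricConnectionSets.

(** * A point stabiliser element centralising the core *)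

Section Centraliser.
Local Open Scope group_scope.
Variable gT : finGroupType.
Local Notation rho := (actperm ('R)%act : gT -> {perm gT}).

Lemma rhoE (x y : gT) : rho x y = y * x.
Proof. exact: actpermE. Qed.

Lemma rho_inj : injective rho.
Proof.
by move=> x y /(congr1 (fun f : {perm gT} => f 1)); rewrite !rhoE !mul1g.
Qed.

(* The conjugate of [rho x] by c stays in the regular group, so it is determined
   by its value at 1, which is [c x]. *)
Lemma rho_commute_fixed (N : {group {perm gT}}) (c : {perm gT}) (x : gT) :
    N \subset right_regular gT -> c \in 'N(N) -> c 1 = 1 -> c x = x ->
  rho x \in N -> commute (rho x) c.
Proof.
move=> sNR nNc c1 cx Nx.
have /(subsetP sNR)/morphimP[y _ _ eq_y] : rho x ^ c \in N by rewrite memJ_norm.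
have c'1 : c^-1 1 = 1 by rewrite -{1}c1 permK.
have: (rho x ^ c) 1 = x by rewrite conjgE !permM c'1 rhoE mul1g.
rewrite eq_y rhoE mul1g => eq_yx; move: eq_y; rewrite eq_yx => eq_x.
by apply/commgP/conjg_fixP.
Qed.

(** The tuple generates the preimage of the core in [gT]. By pigeonhole two elements of the
    stabiliser agree on it; their quotient fixes the generators, hence centralises the core. *)
Lemma mem_moving_automorphism_sets (S : {set gT}) (G : {group {perm gT}}) :
    G \subset dgAut (cayley_arc S) ->
    (#|gT| ^ trunc_log 2 #|gT| < #|'C_G[1%g | 'P]|)%N ->
  exists t : (trunc_log 2 #|gT|).-tuple gT,
    #|<<[set x in t]>>| = #|gcore (right_regular gT) G| /\
    S \in moving_automorphism_sets <<[set x in t]>>.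
Proof.
move=> sGA lt_st; pose N := [group of gcore (right_regular gT) G].
have sNR : N \subset right_regular gT by exact: gcore_sub.
have [t gen_t] := generating_tuple ([morphism of actperm 'R] @*^-1 N).
have im_t : [morphism of actperm 'R] @* <<[set x in t]>> = N.
  by rewrite gen_t morphpreK.
have inj_rho : 'injm [morphism of actperm 'R : gT -> {perm gT}].
  by apply/injmP => x y _ _; exact: rho_inj.
exists t; split; first by rewrite -im_t card_injm ?subsetT.
have [g [h [Cg Ch ngh eq_gh]]] : exists g h,
   [/\ g \in 'C_G[1 | 'P], h \in 'C_G[1 | 'P], g != h & map_tuple g t = map_tuple h t].
  have /dinjectivePn[g Cg [h /andP[nhg Ch] eq_gh]] :
      ~~ dinjectiveb (fun g : {perm gT} => map_tuple g t) (mem 'C_G[1 | 'P]).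
    apply/negP => /dinjectiveP/leq_card_in.
    by rewrite card_tuple leqNgt lt_st.
  by exists g, h; rewrite eq_sym.
move: Cg Ch => /setIP[Gg /astab1P g1] /setIP[Gh /astab1P h1].
rewrite /= !apermE in g1 h1.
(* Permutations compose from left to right, so [c x] is [h^-1 (g x)], which is [x] wherever [g] and
   [h] agree. *)
pose c := g * h^-1; have Gc : c \in G by rewrite groupM ?groupV.
have c1 : c 1 = 1 by rewrite permM g1 -{1}h1 permK.
have ct x : x \in t -> c x = x.
  case/tnthP=> i ->; rewrite permM.
  have /(congr1 (fun u => tnth u i)) := eq_gh.
  by rewrite !tnth_map => ->; rewrite permK.
have cN : N \subset 'C[c].
  rewrite -im_t morphim_gen ?subsetT // gen_subG.
  apply/subsetP => _ /morphimP[x _ tx ->]; apply/cent1P.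
  rewrite inE in tx;
  apply: (rho_commute_fixed sNR _ c1 (ct x tx)).
    by apply: (subsetP (gcore_norm _ _)).
  by rewrite -im_t mem_morphim ?mem_gen ?inE.
rewrite inE; apply/existsP; exists c; apply/and4P; split.
- apply/equivariantP => x h' Hh'.
  have /cent1P/(congr1 (fun u : {perm gT} => u x)) : rho h' \in 'C[c].
    by apply: (subsetP cN); rewrite -im_t mem_morphim ?inE.
  by rewrite !permM !rhoE.
- by rewrite /c -eq_mulgV1.
- by rewrite c1.
- exact: (subsetP sGA).
Qed.

End Centraliser.

(** * Estimates for the binary logarithm *)

Section Log2.
Local Open Scope ring_scope.
Variable K : realType.
Implicit Types x y : K.

(** The inequality [1 + x <= expR x] at [x = -1/2] gives [expR (1/2) <= 2]. *)
Lemma ln2_ge : 1 / 2 <= ln 2 :> K.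
Proof.
rewrite -ler_expR lnK ?posrE //.
have := expR_ge1Dx (- (1 / 2) : K); rewrite expRN => le_inv.
have e_gt0 := expR_gt0 (1 / 2 : K).
have := mulVf (lt0r_neq0 e_gt0); nra.
Qed.

Lemma ln2_gt0 : 0 < ln 2 :> K.
Proof. have := ln2_ge; lra. Qed.

Lemma powR2_log2 x : 0 < x -> 2 `^ log2 x = x.
Proof.
move=> x_gt0; rewrite /powR pnatr_eq0 /= /log2 divfK ?lnK ?posrE //.
exact: lt0r_neq0 ln2_gt0.
Qed.

Lemma ler_powR2 x y : (2 `^ x <= 2 `^ y) = (x <= y).
Proof. by rewrite /powR pnatr_eq0 /= ler_expR ler_pM2r // ln2_gt0. Qed.

Lemma powR2D x y : 2 `^ (x + y) = 2 `^ x * 2 `^ y.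
Proof. by rewrite powRD // pnatr_eq0 implybT. Qed.

Lemma log2_le x : 0 < x -> log2 x <= 2 * x.
Proof.
move=> x_gt0; rewrite /log2 ler_pdivrMr ?ln2_gt0 //.
have := ln_sublinear x_gt0; have := ln2_ge; nra.
Qed.

Lemma log2_expR1 : log2 (expR 1) <= 2 :> K.
Proof. by rewrite /log2 expRK ler_pdivrMr ?ln2_gt0 //; have := ln2_ge; lra. Qed.

(** For [d = 1/2 - eps] the second bound makes the stabiliser larger than [r ^ trunc_log 2 r]; the
    first serves the final numerical comparison. *)
Lemma eventually_log2 (d : K) : 0 < d ->
  exists n : nat, forall k : nat, (n <= k)%N ->
    256 <= log2 (k%:R : K) /\ log2 (k%:R : K) ^+ 2 <= k%:R `^ d.
Proof.
(* With [t = ln k], the bound [(2 * t) ^ 2 <= (d * t / 3) ^ 3] holds once [t >= 108 / d ^ 3]. *)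
move=> d_gt0; pose M := 256 + 108 / d ^+ 3.
have M_ge : 256 <= M by rewrite /M lerDl divr_ge0 ?exprn_ge0 ?ltW.
exists (Num.bound (expR M)) => k le_k.
have k_ge : expR M <= k%:R.
  apply: ltW (lt_le_trans (archi_boundP (expR_ge0 M)) _).
  by rewrite ler_nat.
have k_gt0 : 0 < k%:R :> K := lt_le_trans (expR_gt0 M) k_ge.
have ln_k : M <= ln k%:R by rewrite -ler_expR lnK.
set t := ln (k%:R) in ln_k *; have l2 := ln2_ge.
have l2_le : ln 2 <= 1 :> K.
  by have := @le_ln1Dx K 1; rewrite -[1 + 1]/2%:R; apply; lra.
have t_log : t <= log2 (k%:R : K).
  by rewrite /log2 ler_pdivlMr ?ln2_gt0 // -/t ler_piMr //; lra.
have log_t : log2 (k%:R : K) <= 2 * t.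
  rewrite /log2 ler_pdivrMr ?ln2_gt0 // -/t; nra.
split; first lra.
have -> : k%:R `^ d = expR (d * t / 3) ^+ 3.
  by rewrite -expRM_natl /powR gt_eqF //= -/t; congr expR; field.
have dt_ge0 : 0 <= d * t / 3 by rewrite divr_ge0 // mulr_ge0; lra.
apply: (@le_trans _ _ ((d * t / 3) ^+ 3)); last first.
  by rewrite lerXn2r ?nnegrE ?expR_ge0 //; have := expR_ge1Dx (d * t / 3); lra.
apply: (@le_trans _ _ ((2 * t) ^+ 2)); first by rewrite lerXn2r ?nnegrE; lra.
have : 108 <= d ^+ 3 * t.
  rewrite mulrC -ler_pdivrMr ?exprn_gt0 //; move: ln_k; rewrite /M; lra.
have : 0 <= t ^+ 2 by exact: sqr_ge0.
rewrite -subr_ge0 => t2 h.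
have -> : (d * t / 3) ^+ 3 = t ^+ 2 * (d ^+ 3 * t) / 27 by field.
by rewrite ler_pdivlMr // exprMn; nra.
Qed.

End Log2.

Local Open Scope ring_scope.

(** * Numerical comparison of the bounds *)

Section Thresholds.
Variable K : realType.

Lemma expn_trunc_log_le (n : nat) : (0 < n)%N ->
  (n ^ trunc_log 2 n)%:R <= 2 `^ (log2 n%:R ^+ 2) :> K.
Proof.
move=> n_gt0; have n_gt0K : 0 < n%:R :> K by rewrite ltr0n.
have := trunc_logP (isT : 1 < 2)%N n_gt0; set L := trunc_log 2 n => le_n.
have L_le : L%:R <= log2 n%:R :> K.
  by rewrite -ler_powR2 powR2_log2 // powR_mulrn // -natrX ler_nat.
have L_ge0 : 0 <= L%:R :> K by rewrite ler0n.
rewrite natrX -{1}(powR2_log2 n_gt0K) -powR_mulrn ?powR_ge0 // -powRrM ler_powR2.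
rewrite expr2 ler_wpM2l //; lra.
Qed.

Lemma expn4_lt_exp2 (n k : nat) : (0 < n)%N ->
  4 * log2 n%:R < k%:R :> K -> (n ^ 4 < 2 ^ k)%N.
Proof.
move=> n_gt0 lt_k; have n_gt0K : 0 < n%:R :> K by rewrite ltr0n.
rewrite -(ltr_nat K) !natrX -(powR2_log2 n_gt0K).
rewrite -[_ ^+ 4]powR_mulrn ?powR_ge0 // -powRrM -powR_mulrn //.
by rewrite ltNge ler_powR2 -ltNge mulrC.
Qed.

(** The left exponent is at most [l ^ 2 + 2 * l + 2 + r - r / 16], and the subtracted terms on the
    right are at most [r / 512 + 8 * l]. What remains, [9 * l + 2 <= 31 * r / 512], follows from
    [r >= 256 * l]. *)
Lemma count_le (r : nat) : let l := log2 (r%:R : K) in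
    256 <= l -> l ^+ 2 <= r%:R ->
  (r ^ trunc_log 2 r * (2 * r ^ 2 * 2 ^ (r - r %/ 16)))%:R
    <= 2 `^ (r%:R - r%:R / (4 * l) * log2 (expR 1) - log2 (4 * l) + l ^+ 2 + l).
Proof.
move=> l l_ge l2_le; have r_ge : 256 * l <= r%:R by nra.
have r_gt0 : (0 < r)%N by rewrite -(ltr_nat K); lra.
have r_gt0K : 0 < r%:R :> K by rewrite ltr0n.
have le_q : (r - r %/ 16)%:R <= r%:R - r%:R / 16 + 1 :> K.
  rewrite natrB ?leq_div // -addrA lerD2l lerNl opprD opprK lerBlDr.
  rewrite ler_pdivrMr // natr1 -natrM ler_nat; lia.
rewrite natrM; apply: le_trans (ler_wpM2r (ler0n _ _) (expn_trunc_log_le r_gt0)) _.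
rewrite -/l natrM (natrM _ 2).
have -> : (r ^ 2)%:R = 2 `^ (2 * l) :> K.
  by rewrite natrX mulrC powRrM powR2_log2 // powR_mulrn ?ltW.
have two : 2 = 2 `^ 1 :> K by rewrite powRr1.
rewrite [X in _ * (X * _ * _)]two natrX -(@powR_mulrn _ 2) // -!powR2D ler_powR2.
have le1 : r%:R / (4 * l) * log2 (expR 1) <= r%:R / 512.
  have -> : r%:R / 512 = r%:R / (4 * 256) * 2 :> K by field.
  have inv_le : r%:R / (4 * l) <= r%:R / (4 * 256).
    apply: ler_wpM2l; first exact: ltW.
    by rewrite lef_pV2 ?posrE; lra.
  have inv_ge0 : 0 <= r%:R / (4 * l) by rewrite divr_ge0 //; lra.
  apply: (le_trans (ler_wpM2l inv_ge0 (log2_expR1 K))).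
  by rewrite ler_wpM2r.
have le2 : log2 (4 * l) <= 8 * l.
  by apply: le_trans (log2_le _) _; lra.
lra.
Qed.

End Thresholds.

(** * The union bound over generating tuples of the core *)

Theorem theorem3p4 (K : realType) (eps : K) (eps_gt0 : 0 < eps) (eps_lt : eps < 1 / 2) :
  exists r_eps : nat, forall gT : finGroupType, (r_eps <= #|gT|)%N ->
    let r : K := #|gT|%:R in
    let R := right_regular gT in
    #|[set S : {set gT} |
        [exists G : {group {perm gT}},
          [&& G \subset dgAut (cayley_arc S),
              R \proper G,
              maximal R G,
              (2 `^ (r `^ (1 / 2 - eps)) < #|('C_G[1%g | 'P])%g|%:R :> K)
            & (4 * log2 r < #|gcore R G|%:R)]]]|%:R
    <= 2 `^ (r - r / (4 * log2 r) * log2 (expR 1)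
               - log2 (4 * log2 r) + log2 r ^+ 2 + log2 r) :> K.
Proof.
have d_gt0 : 0 < 1 / 2 - eps by lra.
have [n0 large] := eventually_log2 d_gt0.
exists (maxn 1024 n0) => gT r_ge_max.
cbv zeta; set r : K := #|gT|%:R.
have [r_ge /large[l_ge l2_le]] : (1024 <= #|gT|)%N /\ (n0 <= #|gT|)%N by lia.
have r_gt0 : (0 < #|gT|)%N by lia.
have r_ge1 : 1 <= r by rewrite ler1n.
have l2_le_r : log2 r ^+ 2 <= r.
  apply: le_trans l2_le _; rewrite -[X in _ <= X](@powRr1 _ r); last by lra.
  by rewrite ler_powR //; lra.
apply: le_trans (count_le l_ge l2_le_r); rewrite ler_nat.
pose bad (t : (trunc_log 2 #|gT|).-tuple gT) :=
  moving_automorphism_sets [group of <<[set x in t]>>%g].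
rewrite -[X in (X * _)%N]card_tuple.
(* Only tuples generating a subgroup of order above [4 log2 r] are kept, so that the bound on
   [bad t] applies to each. *)
pose T0 := [set t : (trunc_log 2 #|gT|).-tuple gT |
  (#|gT| ^ 4 < 2 ^ #|<<[set x in t]>>%g|)%N].
apply: (@leq_trans (#|T0| * (2 * #|gT| ^ 2 * 2 ^ (#|gT| - #|gT| %/ 16)))%N); last first.
  by rewrite leq_mul2r max_card orbT.
apply: (@card_covered_le _ _ T0 bad) => [S | t].
  rewrite inE => /existsP[G /and5P[sGA _ _ lt_st lt_core]].
  have [|t [card_t bad_t]] := mem_moving_automorphism_sets sGA.
    rewrite -(ltr_nat K); apply: le_lt_trans lt_st.
    apply: le_trans (expn_trunc_log_le K r_gt0) _.
    by rewrite ler_powR2.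
  exists t => //; rewrite inE card_t; exact: (@expn4_lt_exp2 K).
by rewrite inE => lt_t; exact: card_moving_automorphism_sets.
Qed.
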